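(* Let $K$ be a finite simplicial complex made of tetrahedra and their faces such that every 2-face belongs to the boundaries of exactly two tetrahedra, lying on its different sides. Let a length $l_c$ be assigned to each edge $c$ of $K$, so that each tetrahedron of $K$ becomes a nondegenerate Euclidean tetrahedron, and let $\omega_c$ be the defect angle at the edge $c$. Then for any two edges $a$ and $b$ of $K$ $$\left.\frac{\partial \omega_a}{\partial l_b}\right|_{l_c\ \text{constant for } c\ne b}=\left.\frac{\partial \omega_b}{\partial l_a}\right|_{l_c\ \text{constant for } c\ne a}.$$
   Context: For an edge $a$ of $K$, the defect angle $\omega_a$ is defined up to a multiple of $2\pi$ by $$\omega_a\equiv-\alpha-\beta-\cdots-\eta \pmod{2\pi},$$ where $\alpha,\beta,\ldots,\eta$ are the interior dihedral angles at the edge $a$ in all tetrahedra of $K$ containing $a$. Each dihedral angle is a function of the lengths of the edges of its tetrahedron, so the defect angles are (modulo $2\pi$) smooth functions of the edge lengths, and their partial derivatives are well defined. The assigned lengths are not required to make the defect angles vanish. *)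

(* Defs.v *)
From HB Require Import structures.
From mathcomp Require Import all_boot all_order all_algebra.
From mathcomp Require Import all_classical all_reals all_analysis.

Set Implicit Arguments.
Unset Strict Implicit.
Unset Printing Implicit Defensive.

Import Order.TTheory GRing.Theory Num.Theory.
Import numFieldNormedType.Exports.

Local Open Scope classical_set_scope.
Local Open Scope ring_scope.

(* Simplices are identified with their nonempty sets of vertices, so a
   k-dimensional simplex is a set with k.+1 elements. *)
Definition simplicial_complex (V : finType) (K : {set {set V}}) : Prop :=
  (finset.set0 \notin K) /\
  (forall s t : {set V},
     s \in K -> t \subset s -> t != finset.set0 -> t \in K).

Definition tetrahedra (V : finType) (K : {set {set V}}) : {set {set V}} :=
  [set t in K | #|t| == 4%N]%SET.

Definition triangles (V : finType) (K : {set {set V}}) : {set {set V}} :=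
  [set f in K | #|f| == 3%N]%SET.

Definition made_of_tetrahedra (V : finType) (K : {set {set V}}) : Prop :=
  forall s : {set V}, s \in K -> exists2 t, t \in tetrahedra K & s \subset t.

(* A tetrahedron of a simplicial complex is determined by its vertices.  Two
   distinct tetrahedra with a common 2-face f thus have distinct apices over f
   and meet exactly along f, so they lie on different sides of f. *)
Definition two_tetrahedra_at_each_face (V : finType) (K : {set {set V}}) :
    Prop :=
  forall f : {set V}, f \in triangles K ->
    #|[set t in tetrahedra K | f \subset t]%SET| = 2%N.

Definition edge (V : finType) (K : {set {set V}}) : Type :=
  {e : {set V} | (e \in K) && (#|e| == 2%N)}.

HB.instance Definition _ (V : finType) (K : {set {set V}}) :=
  SubFinite.copy (edge K) {e : {set V} | (e \in K) && (#|e| == 2%N)}.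

(* Since there are finitely many edges, the topology of pointwise convergence
   is the usual topology of the space of real vectors indexed by the edges. *)
Definition edge_lengths (R : realType) (V : finType) (K : {set {set V}}) :=
  {ptws edge K -> R}.

(* The norm of the library on row vectors is the sup norm, hence the Euclidean
   structure below. *)
Definition dotv (R : realType) (u v : 'rV[R]_3) : R :=
  \sum_(i < 3) u ord0 i * v ord0 i.

Definition enorm (R : realType) (u : 'rV[R]_3) : R := Num.sqrt (dotv u u).

Definition angle (R : realType) (u v : 'rV[R]_3) : R :=
  acos (dotv u v / (enorm u * enorm v)).

Definition orth_part (R : realType) (u v : 'rV[R]_3) : 'rV[R]_3 :=
  v - (dotv v u / dotv u u) *: u.

(* The angle between the half-planes bounded by the line AB and passing
   through C and D respectively. *)
Definition dihedral (R : realType) (A B C D : 'rV[R]_3) : R :=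
  angle (orth_part (B - A) (C - A)) (orth_part (B - A) (D - A)).

Definition affinely_independent (R : realType) (V : finType) (t : {set V})
    (p : V -> 'rV[R]_3) : Prop :=
  forall c : V -> R,
    \sum_(x in t) c x = 0 -> \sum_(x in t) c x *: p x = 0 ->
    forall x, x \in t -> c x = 0.

(* [p] places the vertices of [t] in space; its values outside [t] are
   irrelevant. *)
Definition realizes (R : realType) (V : finType) (K : {set {set V}})
    (l : edge_lengths R K) (t : {set V}) (p : V -> 'rV[R]_3) : Prop :=
  affinely_independent t p /\
  forall (e : edge K) (x y : V),
    \val e = [set x; y]%SET -> \val e \subset t -> enorm (p x - p y) = l e.

Definition euclidean_tetrahedron (R : realType) (V : finType) (K : {set {set V}})
    (l : edge_lengths R K) (t : {set V}) : Prop :=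
  exists p : V -> 'rV[R]_3, realizes l t p.

(* The lengths determine the tetrahedron up to isometry, so all realizations
   and all namings of the vertices give the same angle. *)
Definition dihedral_angle (R : realType) (V : finType) (K : {set {set V}})
    (l : edge_lengths R K) (t : {set V}) (a : edge K) : R :=
  get [set theta : R | exists (p : V -> 'rV[R]_3) (x y z w : V),
    [/\ realizes l t p,
        \val a = [set x; y]%SET,
        t = [set x; y; z; w]%SET
      & theta = dihedral (p x) (p y) (p z) (p w)]].

Definition angle_sum (R : realType) (V : finType) (K : {set {set V}})
    (l : edge_lengths R K) (a : edge K) : R :=
  \sum_(t in tetrahedra K | \val a \subset t) dihedral_angle l t a.

Definition eq_mod_2pi (R : realType) (x y : R) : Prop :=
  exists k : int, x = y + 2 * pi * k%:~R.

(* Defect angles are only defined up to multiples of 2 pi; [omega] is any choice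
   of them, as functions of the lengths, that is valid near [l] and continuous
   at [l].  Without the continuity the multiple could jump and the derivatives
   at [l] would make no sense. *)
Definition defect_angles_near (R : realType) (V : finType) (K : {set {set V}})
    (l : edge_lengths R K) (omega : edge K -> edge_lengths R K -> R) : Prop :=
  forall a : edge K,
    {for l, continuous (omega a)} /\
    \forall l' \near l, eq_mod_2pi (omega a l') (- angle_sum l' a).

Definition along (R : realType) (V : finType) (K : {set {set V}})
    (F : edge_lengths R K -> R) (l : edge_lengths R K) (b : edge K) (s : R) :
    R :=
  F [eta l with b |-> s].

(* Main.v *)
Require Import Defs.
From mathcomp Require Import all_boot all_order all_algebra.
From mathcomp Require Import all_classical all_reals all_analysis.
From mathcomp Require Import ring lra.
Set Implicit Arguments.
Unset Strict Implicit.
Unset Printing Implicit Defensive.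

Import Order.TTheory GRing.Theory Num.Theory.
Import numFieldNormedType.Exports.
Local Open Scope classical_set_scope.
Local Open Scope ring_scope.

(** Why the Jacobian is symmetric.  The defect angle at [a] is, up to sign and a
    constant multiple of 2 pi, the sum of the dihedral angles at [a] in the
    tetrahedra around [a], so it is enough to prove
    d theta_a / d l_b = d theta_b / d l_a inside one Euclidean tetrahedron,
    for any two of its edges [a] and [b] (lemma [tetrahedron_schlafli]); a
    tetrahedron that does not contain [b] contributes 0.

    Inside a tetrahedron x y z w the Gram matrix at x is a linear function of
    the squared lengths, and the dihedral angle at xy is
    acos (N / sqrt (M M')), where M and M' are four times the squared areas of
    the faces xyz and xyw and M M' - N^2 = |xy|^2 G, with G the Gram
    determinant (lemma [area_mul]).  Differentiating gives
    - for opposite edges a = xy and b = zw, the value l_a l_b / sqrt G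
      (lemma [ddihq_opposite]);
    - for adjacent edges a = xy and b = xz, the value - l_a l_b Q / (M sqrt G),
      where Q is unchanged when y and z are exchanged (lemmas
      [ddihq_adjacent] and [adjacent_factor_sym]).
    Both are symmetric in a and b.

    Dihedral angles are defined through placements of the tetrahedron in space,
    so the formula has to hold on a neighbourhood of the given lengths.  For
    positive lengths, the leading minors of the Gram matrix are positive exactly
    when a nondegenerate tetrahedron has these lengths: one direction is
    [affinely_independent_gt0], the other is a Cholesky decomposition
    ([exists_gram_vectors]); positivity of the minors is an open condition.
    Finally, along one varying length, a choice of the defect angle that is
    continuous at the given lengths differs from minus the angle sum by a fixed
    multiple of 2 pi nearby
    ([near_constant_mod_2pi]). *)

(** * Dihedral angles in terms of squared lengths *)

(** In this part [q u v] stands for the squared distance between the vertices u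
    and v.  [gram q x y z] is the scalar product of y - x and z - x, given by
    the law of cosines. *)
Definition gram (R : realType) (V : Type) (q : V -> V -> R) (x y z : V) : R :=
  (q x y + q x z - q y z) / 2.

(** Four times the squared area of the triangle xyz. *)
Definition area (R : realType) (V : Type) (q : V -> V -> R) (x y z : V) : R :=
  q x y * q x z - gram q x y z ^+ 2.

(** The scalar product of the components of z - x and w - x orthogonal to
    y - x, multiplied by |y - x|^2: the numerator of the cosine of the dihedral
    angle at xy. *)
Definition cosnum (R : realType) (V : Type) (q : V -> V -> R) (x y z w : V) : R :=
  q x y * gram q x z w - gram q x y z * gram q x y w.

(** The determinant of the Gram matrix of y - x, z - x and w - x: 36 times the
    squared volume of the tetrahedron. *)
Definition gramdet (R : realType) (V : Type) (q : V -> V -> R) (x y z w : V) : R :=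
  q x y * q x z * q x w + 2 * gram q x y z * gram q x y w * gram q x z w
  - q x y * gram q x z w ^+ 2 - q x z * gram q x y w ^+ 2
  - q x w * gram q x y z ^+ 2.

(** The dihedral angle at the edge xy of the tetrahedron x y z w. *)
Definition dihq (R : realType) (V : Type) (q : V -> V -> R) (x y z w : V) : R :=
  acos (cosnum q x y z w / Num.sqrt (area q x y z * area q x y w)).

(** Derivatives of the quantities above, when [q] varies with derivative [dq].
    The quantity [gram] is linear in [q], so its derivative is [gram dq]. *)
Definition darea (R : realType) (V : Type) (q dq : V -> V -> R) (x y z : V) : R :=
  dq x y * q x z + q x y * dq x z - 2 * gram q x y z * gram dq x y z.

Definition dcosnum (R : realType) (V : Type) (q dq : V -> V -> R) (x y z w : V) : R :=
  dq x y * gram q x z w + q x y * gram dq x z w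
  - gram dq x y z * gram q x y w - gram q x y z * gram dq x y w.

Definition ddihq (R : realType) (V : Type) (q dq : V -> V -> R) (x y z w : V) : R :=
  - (dcosnum q dq x y z w - cosnum q x y z w / 2 *
       (darea q dq x y z / area q x y z + darea q dq x y w / area q x y w))
  / Num.sqrt (q x y * gramdet q x y z w).

(** Sylvester's determinant identity for the Gram matrix; it computes the sine
    of the dihedral angle. *)
Lemma area_mul (R : realType) (V : Type) (q : V -> V -> R) (x y z w : V) :
  area q x y z * area q x y w - cosnum q x y z w ^+ 2
  = q x y * gramdet q x y z w.
Proof. rewrite /area /cosnum /gramdet; ring. Qed.

(** Here [c] and [e] are the lengths of zw and xy, and only zw varies. *)
Lemma ddihq_opposite (R : realType) (V : Type) (q dq : V -> V -> R)
    (x y z w : V) (c e : R) :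
  0 < e -> q x y = e ^+ 2 ->
  dq x y = 0 -> dq x z = 0 -> dq x w = 0 -> dq y z = 0 -> dq y w = 0 ->
  dq z w = 2 * c ->
  ddihq q dq x y z w = c * e / Num.sqrt (gramdet q x y z w).
Proof.
move=> e0 qxy dxy dxz dxw dyz dyw dzw; rewrite /ddihq.
have -> : darea q dq x y z = 0.
  by rewrite /darea /gram dxy dxz dyz; ring.
have -> : darea q dq x y w = 0.
  by rewrite /darea /gram dxy dxw dyw; ring.
rewrite !mul0r addr0 mulr0 subr0.
have -> : dcosnum q dq x y z w = - (e ^+ 2 * c).
  by rewrite /dcosnum /gram dxy dxz dxw dyz dyw dzw qxy; field.
rewrite qxy sqrtrM ?sqr_ge0// sqrtr_sqr gtr0_norm// opprK invfM.
rewrite mulrA; congr (_ * _); field; exact: lt0r_neq0.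
Qed.

(** The factor, besides the two lengths, in the numerator of the derivative of
    the angle at xy with respect to the length of xz. *)
Definition adjacent_factor (R : realType) (V : Type) (q : V -> V -> R)
    (x y z w : V) : R :=
  q x y * q x z - gram q x y z ^+ 2 - gram q x y w * q x z
  - q x y * gram q x z w + gram q x y z * (gram q x z w + gram q x y w).

(** Here [c] and [e] are the lengths of xz and xy, and only xz varies. *)
Lemma ddihq_adjacent (R : realType) (V : Type) (q dq : V -> V -> R)
    (x y z w : V) (c e : R) :
  0 < e -> 0 < area q x y z -> q x y = e ^+ 2 ->
  dq x y = 0 -> dq x w = 0 -> dq y z = 0 -> dq y w = 0 -> dq z w = 0 ->
  dq x z = 2 * c ->
  ddihq q dq x y z w = - (c * e * adjacent_factor q x y z w
    / (area q x y z * Num.sqrt (gramdet q x y z w))).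
Proof.
move=> e0 a0 qxy dxy dxw dyz dyw dzw dxz; rewrite /ddihq.
have -> : darea q dq x y w = 0.
  by rewrite /darea /gram dxy dxw dyw; ring.
rewrite !mul0r addr0.
rewrite qxy sqrtrM ?sqr_ge0// sqrtr_sqr gtr0_norm// 2!invfM.
rewrite -!mulNr [in RHS]mulrA [in LHS]mulrA; congr (_ * _).
have /lt0r_neq0 e0' := e0; have /lt0r_neq0 a0' := a0.
apply/eqP; rewrite eqr_div//; apply/eqP.
set A := area _ _ _ _ in a0 a0' *.
have -> : darea q dq x y z = 2 * c * (q x y - gram q x y z).
  by rewrite /darea /gram dxy dxz dyz; field.
have -> : dcosnum q dq x y z w = c * (q x y - gram q x y w).
  by rewrite /dcosnum /gram dxy dxz dxw dyz dyw dzw; field.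
transitivity (- c * ((q x y - gram q x y w) * A
    - cosnum q x y z w * (q x y - gram q x y z))); first by field.
transitivity (- c * (e ^+ 2 * adjacent_factor q x y z w)); last by ring.
rewrite -qxy /A /area /cosnum /adjacent_factor; ring.
Qed.

Lemma gram_sym (R : realType) (V : Type) (q : V -> V -> R) (x y z : V) :
  (forall u v, q u v = q v u) -> gram q x y z = gram q x z y.
Proof. by move=> qC; rewrite /gram (qC z y) [q x y + _]addrC. Qed.

Lemma gramdet_opposite (R : realType) (V : Type) (q : V -> V -> R) (x y z w : V) :
  (forall u v, q u v = q v u) -> gramdet q z w x y = gramdet q x y z w.
Proof.
by move=> qC; rewrite /gramdet /gram (qC z x) (qC z y) (qC w x) (qC w y); field.
Qed.

Lemma gramdet_adjacent (R : realType) (V : Type) (q : V -> V -> R) (x y z w : V) :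
  (forall u v, q u v = q v u) -> gramdet q x z y w = gramdet q x y z w.
Proof. by move=> qC; rewrite /gramdet /gram (qC z y); field. Qed.

Lemma area_adjacent (R : realType) (V : Type) (q : V -> V -> R) (x y z : V) :
  (forall u v, q u v = q v u) -> area q x z y = area q x y z.
Proof. by move=> qC; rewrite /area /gram (qC z y); field. Qed.

Lemma adjacent_factor_sym (R : realType) (V : Type) (q : V -> V -> R)
    (x y z w : V) :
  (forall u v, q u v = q v u) ->
  adjacent_factor q x z y w = adjacent_factor q x y z w.
Proof. by move=> qC; rewrite /adjacent_factor /gram (qC z y); field. Qed.

Lemma dihq_swap_apices (R : realType) (V : Type) (q : V -> V -> R) (x y z w : V) :
  (forall u v, q u v = q v u) -> dihq q x y w z = dihq q x y z w.
Proof.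
move=> qC; rewrite /dihq [area q x y w * _]mulrC; congr (acos (_ / _)).
by rewrite /cosnum (gram_sym x w z qC) [gram q x y w * _]mulrC.
Qed.

Lemma dihq_swap_ends (R : realType) (V : Type) (q : V -> V -> R) (x y z w : V) :
  (forall u v, q u v = q v u) -> dihq q y x z w = dihq q x y z w.
Proof.
move=> qC.
have areaC v : area q y x v = area q x y v.
  by rewrite /area /gram (qC y x); field.
rewrite /dihq !areaC; congr (acos (_ / _)).
by rewrite /cosnum /gram (qC y x); field.
Qed.

(** * Derivative of the dihedral angle *)

Lemma is_derive_gram (R : realType) (V : Type) (q : R -> V -> V -> R)
    (dq : V -> V -> R) (s0 : R) (x y z : V) :
  (forall u v, is_derive s0 1 (fun s => q s u v) (dq u v)) ->
  is_derive s0 1 (fun s => gram (q s) x y z) (gram dq x y z).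
Proof.
move=> qD; have H := is_deriveM (is_deriveB
  (is_deriveD (qD x y) (qD x z)) (qD y z)) (is_derive_cst (2^-1 : R) s0 1).
apply: (is_derive_eq H); rewrite /gram /GRing.scale /=; ring.
Qed.

Lemma is_derive_area (R : realType) (V : Type) (q : R -> V -> V -> R)
    (dq : V -> V -> R) (s0 : R) (x y z : V) :
  (forall u v, is_derive s0 1 (fun s => q s u v) (dq u v)) ->
  is_derive s0 1 (fun s => area (q s) x y z) (darea (q s0) dq x y z).
Proof.
move=> qD; have gD := is_derive_gram x y z qD.
have H := is_deriveB (is_deriveM (qD x y) (qD x z)) (is_deriveM gD gD).
apply: (is_derive_eq H); rewrite /darea /GRing.scale /=; ring.
Qed.

Lemma is_derive_cosnum (R : realType) (V : Type) (q : R -> V -> V -> R)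
    (dq : V -> V -> R) (s0 : R) (x y z w : V) :
  (forall u v, is_derive s0 1 (fun s => q s u v) (dq u v)) ->
  is_derive s0 1 (fun s => cosnum (q s) x y z w) (dcosnum (q s0) dq x y z w).
Proof.
move=> qD.
have H := is_deriveB (is_deriveM (qD x y) (is_derive_gram x z w qD))
  (is_deriveM (is_derive_gram x y z qD) (is_derive_gram x y w qD)).
apply: (is_derive_eq H); rewrite /dcosnum /GRing.scale /=; ring.
Qed.

Lemma is_derive_div_sqrt (R : realType) (f g : R -> R) (df dg s : R) :
  is_derive s 1 f df -> is_derive s 1 g dg -> 0 < g s ->
  is_derive s 1 (fun r => f r / Num.sqrt (g r))
    ((df - f s / 2 * (dg / g s)) / Num.sqrt (g s)).
Proof.
move=> fD gD g0.
have g0' : Num.sqrt (g s) != 0 by rewrite lt0r_neq0// sqrtr_gt0.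
have sD := is_derive1_comp (is_derive1_sqrt g0) gD.
have H := is_deriveM fD (@is_deriveV _ (Num.sqrt \o g) _ _ _ g0' sD).
apply: (is_derive_eq H); rewrite /GRing.scale /=.
have := sqr_sqrtr (ltW g0); set r := Num.sqrt _ in g0' *; move=> <-.
by field.
Qed.

Lemma is_derive_acos_div_sqrt (R : realType) (f g : R -> R) (df dg s : R) :
  is_derive s 1 f df -> is_derive s 1 g dg -> 0 < g s ->
  f s ^+ 2 < g s ->
  is_derive s 1 (fun r => acos (f r / Num.sqrt (g r)))
    (- (df - f s / 2 * (dg / g s)) / Num.sqrt (g s - f s ^+ 2)).
Proof.
move=> fD gD g0 fg.
have hD := is_derive_div_sqrt fD gD g0.
set h := fun r => _ in hD.
have hs2 : h s ^+ 2 = f s ^+ 2 / g s by rewrite /h exprMn exprVn sqr_sqrtr// ltW.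
have h1 : -1 < h s < 1.
  by rewrite -ltr_norml -(@ltr_pXn2r _ 2)// ?nnegrE// real_normK ?num_real// expr1n
    hs2 ltr_pdivrMr// mul1r.
have H := is_derive1_comp (is_derive1_acos h1) hD.
apply: (is_derive_eq H); rewrite hs2.
have -> : g s - f s ^+ 2 = g s * (1 - f s ^+ 2 / g s).
  by field; rewrite lt0r_neq0.
rewrite sqrtrM ?ltW// invfM /GRing.scale /=; ring.
Qed.

Lemma is_derive_dihq (R : realType) (V : Type) (q : R -> V -> V -> R)
    (dq : V -> V -> R) (s0 : R) (x y z w : V) :
  (forall u v, is_derive s0 1 (fun s => q s u v) (dq u v)) ->
  0 < q s0 x y -> 0 < area (q s0) x y z -> 0 < area (q s0) x y w ->
  0 < gramdet (q s0) x y z w ->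
  is_derive s0 1 (fun s => dihq (q s) x y z w) (ddihq (q s0) dq x y z w).
Proof.
move=> qD qxy0 a1 a2 vol0.
have a1D := is_derive_area x y z qD; have a2D := is_derive_area x y w qD.
have D : is_derive s0 1 (fun s => area (q s) x y z * area (q s) x y w)
    (area (q s0) x y z * darea (q s0) dq x y w
     + area (q s0) x y w * darea (q s0) dq x y z) := is_deriveM a1D a2D.
have a120 : 0 < area (q s0) x y z * area (q s0) x y w by rewrite mulr_gt0.
have H := is_derive_acos_div_sqrt (is_derive_cosnum x y z w qD) D a120.
apply: (is_derive_eq (H _)); last first.
  rewrite /ddihq area_mul; congr (- (_ - _ * _) / _).
  by field; rewrite !lt0r_neq0.
by rewrite -subr_gt0 area_mul mulr_gt0.
Qed.

(** * Euclidean geometry of a placed tetrahedron *)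

Lemma dotvC (R : realType) (u v : 'rV[R]_3) : dotv u v = dotv v u.
Proof. by apply: eq_bigr => i _; rewrite mulrC. Qed.

Lemma dotvDl (R : realType) (u v w : 'rV[R]_3) :
  dotv (u + v) w = dotv u w + dotv v w.
Proof. by rewrite -big_split; apply: eq_bigr => i _; rewrite mxE mulrDl. Qed.

Lemma dotvZl (R : realType) (k : R) (u v : 'rV[R]_3) :
  dotv (k *: u) v = k * dotv u v.
Proof. by rewrite /dotv mulr_sumr; apply: eq_bigr => i _; rewrite mxE mulrA. Qed.

Lemma dotvNl (R : realType) (u v : 'rV[R]_3) : dotv (- u) v = - dotv u v.
Proof. by rewrite -scaleN1r dotvZl mulN1r. Qed.

Lemma dotvDr (R : realType) (u v w : 'rV[R]_3) :
  dotv u (v + w) = dotv u v + dotv u w.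
Proof. by rewrite dotvC dotvDl !(dotvC u). Qed.

Lemma dotvZr (R : realType) (k : R) (u v : 'rV[R]_3) :
  dotv u (k *: v) = k * dotv u v.
Proof. by rewrite dotvC dotvZl dotvC. Qed.

Lemma dotvNr (R : realType) (u v : 'rV[R]_3) : dotv u (- v) = - dotv u v.
Proof. by rewrite dotvC dotvNl dotvC. Qed.

Definition dotvE := (dotvDl, dotvDr, dotvZl, dotvZr, dotvNl, dotvNr).

Lemma dotv_ge0 (R : realType) (u : 'rV[R]_3) : 0 <= dotv u u.
Proof. by apply: sumr_ge0 => i _; rewrite -expr2 sqr_ge0. Qed.

Lemma dotv_gt0 (R : realType) (u : 'rV[R]_3) : u != 0 -> 0 < dotv u u.
Proof.
rewrite lt_def dotv_ge0 andbT; apply: contraNN => /eqP u0; apply/eqP/rowP => i.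
rewrite mxE; apply/eqP; rewrite -sqrf_eq0 expr2.
have/psumr_eq0P -> // : \sum_(i < 3) u ord0 i * u ord0 i = 0 by exact: u0.
by move=> j _; rewrite -expr2 sqr_ge0.
Qed.

Lemma sqr_enorm (R : realType) (u : 'rV[R]_3) : enorm u ^+ 2 = dotv u u.
Proof. by rewrite sqr_sqrtr// dotv_ge0. Qed.

(** Squared distance between the positions of two vertices. *)
Definition sqdist (R : realType) (V : Type) (p : V -> 'rV[R]_3) (x y : V) : R :=
  dotv (p x - p y) (p x - p y).

Lemma gram_sqdist (R : realType) (V : Type) (p : V -> 'rV[R]_3) (x y z : V) :
  gram (sqdist p) x y z = dotv (p y - p x) (p z - p x).
Proof.
rewrite /gram /sqdist !dotvE (dotvC (p y) (p x)) (dotvC (p z) (p x)) (dotvC (p z) (p y)).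
by field.
Qed.

Lemma sqdistE (R : realType) (V : Type) (p : V -> 'rV[R]_3) (x y : V) :
  sqdist p x y = dotv (p y - p x) (p y - p x).
Proof. by rewrite /sqdist !dotvE; ring. Qed.

Lemma angle_orth_part (R : realType) (u v w : 'rV[R]_3) :
  0 < dotv u u ->
  angle (orth_part u v) (orth_part u w)
  = acos ((dotv u u * dotv v w - dotv u v * dotv u w)
      / Num.sqrt ((dotv u u * dotv v v - dotv u v ^+ 2)
                  * (dotv u u * dotv w w - dotv u w ^+ 2))).
Proof.
move=> u0; have u0' := lt0r_neq0 u0.
have E (a b : 'rV[R]_3) : dotv (orth_part u a) (orth_part u b)
    = (dotv u u * dotv a b - dotv u a * dotv u b) / dotv u u.
  by rewrite /orth_part !dotvE (dotvC a u) (dotvC b u); field.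
rewrite /angle /enorm -sqrtrM ?dotv_ge0// !E -!expr2; congr acos.
set a := _ - _ * _; set b := _ - _; set c := _ - _.
have -> : b / dotv u u * (c / dotv u u) = (dotv u u)^-1 ^+ 2 * (b * c) by field.
rewrite sqrtrM ?sqr_ge0// sqrtr_sqr gtr0_norm ?invr_gt0// invfM invrK.
by rewrite mulrA mulfVK.
Qed.

Lemma dihedral_dihq (R : realType) (V : Type) (p : V -> 'rV[R]_3) (x y z w : V) :
  0 < sqdist p x y ->
  dihedral (p x) (p y) (p z) (p w) = dihq (sqdist p) x y z w.
Proof.
rewrite /dihedral /dihq /area /cosnum !gram_sqdist !sqdistE.
exact: angle_orth_part.
Qed.

(** The leading principal minors of the Gram matrix of three independent vectors
    are positive: up to a positive factor, each is the squared norm of a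
    nontrivial combination of the vectors. *)
Lemma gramdet_gt0_vec (R : realType) (u v w : 'rV[R]_3) :
  (forall a b c, a *: u + b *: v + c *: w = 0 -> [/\ a = 0, b = 0 & c = 0]) ->
  [/\ 0 < dotv u u, 0 < dotv u u * dotv v v - dotv u v ^+ 2 &
    0 < dotv u u * dotv v v * dotv w w + 2 * dotv u v * dotv u w * dotv v w
      - dotv u u * dotv v w ^+ 2 - dotv v v * dotv u w ^+ 2
      - dotv w w * dotv u v ^+ 2].
Proof.
move=> free; set M := _ - _ ^+ 2; set D := _ - _.
have u0 : 0 < dotv u u.
  apply: dotv_gt0; apply/eqP => u0.
  have [] := free 1 0 0; last by move=> /eqP; rewrite oner_eq0.
  by rewrite !scale0r scale1r !addr0.
have M0 : 0 < M.
  rewrite -(pmulr_rgt0 _ u0).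
  have -> : dotv u u * M = dotv (- dotv u v *: u + dotv u u *: v + 0 *: w)
     (- dotv u v *: u + dotv u u *: v + 0 *: w).
    by rewrite scale0r addr0 !dotvE (dotvC v u) /M; ring.
  apply/dotv_gt0/eqP => /free[_ uu _]; by rewrite uu ltxx in u0.
split=> //; rewrite -(pmulr_rgt0 _ M0).
(* M times the component of w orthogonal to u and v. *)
set a := dotv u v * dotv v w - dotv v v * dotv u w.
set b := dotv u v * dotv u w - dotv u u * dotv v w.
have -> : M * D = dotv (a *: u + b *: v + M *: w) (a *: u + b *: v + M *: w).
  by rewrite !dotvE (dotvC v u) (dotvC w u) (dotvC w v) /M /D /a /b; ring.
by apply/dotv_gt0/eqP => /free[_ _ MM]; rewrite MM ltxx in M0.
Qed.

Lemma big_set4 (U : nmodType) (V : finType) (F : V -> U) (x y z w : V) :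
  uniq [:: x; y; z; w] ->
  \sum_(v in [set x; y; z; w]%SET) F v = F x + F y + F z + F w.
Proof.
move=> xyzw; transitivity (\sum_(v <- [:: x; y; z; w]) F v).
  by rewrite big_uniq//; apply: eq_bigl => v; rewrite !inE !orbA.
by rewrite !big_cons big_nil addr0 !addrA.
Qed.

Lemma affinely_independent_gt0 (R : realType) (V : finType) (p : V -> 'rV[R]_3)
    (x y z w : V) :
  uniq [:: x; y; z; w] ->
  affinely_independent [set x; y; z; w]%SET p ->
  [/\ 0 < sqdist p x y, 0 < area (sqdist p) x y z &
      0 < gramdet (sqdist p) x y z w].
Proof.
move=> xyzw ind; rewrite /area /gramdet !gram_sqdist !sqdistE.
apply: gramdet_gt0_vec => a b c abc.
have := xyzw; rewrite /= !inE !negb_or => /and4P[/and3P[xy xz xw] /andP[yz yw] zw _].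
(* The weight of x makes the total weight zero. *)
pose k v := if v == x then - (a + b + c) else if v == y then a
   else if v == z then b else c.
have [kx ky kz kw] : [/\ k x = - (a + b + c), k y = a, k z = b & k w = c].
  by rewrite /k !eqxx ![y == _]eq_sym ![z == _]eq_sym ![w == _]eq_sym (negPf xy)
   (negPf xz) (negPf xw) (negPf yz) (negPf yw) (negPf zw).
have := ind k; rewrite !big_set4// kx ky kz kw => /(_ _ _) k0.
have {}k0 : forall v, v \in [set x; y; z; w]%SET -> k v = 0.
  apply: k0; first by ring.
  rewrite -[RHS]abc !scalerBr scaleNr !scalerDl !opprD.
  by apply/rowP => i; rewrite !mxE; ring.
by rewrite -ky -kz -kw !k0// !inE eqxx ?orbT.
Qed.

(** * Lengths that belong to a tetrahedron *)

Definition vec3 (R : realType) (a b c : R) : 'rV[R]_3 :=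
  \row_(i < 3) nth 0 [:: a; b; c] i.

Lemma dotv_vec3 (R : realType) (a b c a' b' c' : R) :
  dotv (vec3 a b c) (vec3 a' b' c') = a * a' + b * b' + c * c'.
Proof. by rewrite /dotv !big_ord_recl big_ord0 !mxE /= addr0 !addrA. Qed.

(** Cholesky decomposition of a positive definite 3 by 3 matrix. *)
Lemma exists_gram_vectors (R : realType) (g11 g22 g33 g12 g13 g23 : R) :
  0 < g11 -> 0 < g11 * g22 - g12 ^+ 2 ->
  0 < g11 * g22 * g33 + 2 * g12 * g13 * g23 - g11 * g23 ^+ 2
      - g22 * g13 ^+ 2 - g33 * g12 ^+ 2 ->
  exists u v w : 'rV[R]_3,
    [/\ dotv u u = g11, dotv v v = g22 & dotv w w = g33] /\
    [/\ dotv u v = g12, dotv u w = g13 & dotv v w = g23].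
Proof.
set M := _ - _ ^+ 2; set D := _ - _ => g0 M0 D0.
pose r := Num.sqrt g11; pose s := Num.sqrt (M / g11).
pose k := Num.sqrt (D / M).
have r0 : r != 0 by rewrite lt0r_neq0// sqrtr_gt0.
have s0 : s != 0 by rewrite lt0r_neq0// sqrtr_gt0 divr_gt0.
have r2 : r * r = g11 by rewrite -expr2 sqr_sqrtr// ltW.
have s2 : s * s = M / g11 by rewrite -expr2 sqr_sqrtr// ltW// divr_gt0.
have k2 : k * k = D / M by rewrite -expr2 sqr_sqrtr// ltW// divr_gt0.
have g0' := lt0r_neq0 g0; have M0' := lt0r_neq0 M0.
pose N := g11 * g23 - g12 * g13.
exists (vec3 r 0 0), (vec3 (g12 / r) s 0), (vec3 (g13 / r) (N / g11 / s) k).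
rewrite !dotv_vec3 !mulr0 !mul0r !addr0 r2 s2 k2; split; split=> //.
- by rewrite mulf_div r2 /M; field.
- rewrite !mulf_div r2 s2.
  have -> : D = (M * (g11 * g33 - g13 ^+ 2) - N ^+ 2) / g11.
    by rewrite /D /M /N; field.
  by rewrite /N; field; rewrite M0' g0'.
- by rewrite mulrC divfK.
- by rewrite mulrC divfK.
- by rewrite mulf_div r2 (mulrC s) divfK// /N; field.
Qed.

(** Converse of [gramdet_gt0_vec]. *)
Lemma free_gramdet_gt0 (R : realType) (u v w : 'rV[R]_3) :
  0 < dotv u u -> 0 < dotv u u * dotv v v - dotv u v ^+ 2 ->
  0 < dotv u u * dotv v v * dotv w w + 2 * dotv u v * dotv u w * dotv v w
      - dotv u u * dotv v w ^+ 2 - dotv v v * dotv u w ^+ 2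
      - dotv w w * dotv u v ^+ 2 ->
  forall a b c, a *: u + b *: v + c *: w = 0 -> [/\ a = 0, b = 0 & c = 0].
Proof.
set M := _ - _ ^+ 2; set D := _ - _ => u0 M0 D0 a b c abc.
have dot0 n : a * dotv u n + b * dotv v n + c * dotv w n = 0.
  by rewrite -!dotvZl -!dotvDl abc -[X in dotv X _](scale0r n) dotvZl mul0r.
(* The scalar product with the vector orthogonal to u and v isolates c. *)
have c0 : c = 0.
  have := dot0 ((dotv u v * dotv v w - dotv v v * dotv u w) *: u
    + (dotv u v * dotv u w - dotv u u * dotv v w) *: v + M *: w).
  rewrite !dotvE (dotvC v u) (dotvC w u) (dotvC w v) => E.
  have /eqP : c * D = 0 by rewrite -[RHS]E /D /M; ring.
  by rewrite mulf_eq0 (gt_eqF D0) orbF => /eqP.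
have b0 : b = 0.
  have := dot0 (dotv u u *: v - dotv u v *: u).
  rewrite !dotvE (dotvC v u) c0 mul0r addr0 => E.
  have /eqP : b * M = 0 by rewrite -[RHS]E /M; ring.
  by rewrite mulf_eq0 (gt_eqF M0) orbF => /eqP.
have := dot0 u; rewrite b0 c0 !mul0r !addr0 => /eqP.
by rewrite mulf_eq0 (gt_eqF u0) orbF => /eqP.
Qed.

Lemma exists_placement (R : realType) (V : finType) (q : V -> V -> R)
    (x y z w : V) :
  uniq [:: x; y; z; w] -> (forall u v, q u v = q v u) ->
  0 < q x y -> 0 < area q x y z -> 0 < gramdet q x y z w ->
  exists2 p : V -> 'rV[R]_3, affinely_independent [set x; y; z; w]%SET p &
    forall u v, u \in [set x; y; z; w]%SET -> v \in [set x; y; z; w]%SET ->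
      u != v -> sqdist p u v = q u v.
Proof.
move=> xyzw qC q0 a0 d0.
have [u [v [t [[uu vv tt] [uv ut vt]]]]] := exists_gram_vectors q0 a0 d0.
have := xyzw; rewrite /= !inE !negb_or => /and4P[/and3P[xy xz xw] /andP[yz yw] zw _].
pose p k := if k == x then 0 else if k == y then u else if k == z then v else t.
have [px py pz pw] : [/\ p x = 0, p y = u, p z = v & p w = t].
  by rewrite /p !eqxx ![y == _]eq_sym ![z == _]eq_sym ![w == _]eq_sym (negPf xy)
   (negPf xz) (negPf xw) (negPf yz) (negPf yw) (negPf zw).
exists p.
  move=> c; rewrite !big_set4// px py pz pw scaler0 add0r => cs.
  move=> /free_gramdet_gt0; rewrite uu vv tt uv ut vt => /(_ q0 a0 d0)[cy cz cw].
  move: cs; rewrite cy cz cw !addr0 => cx k.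
  by rewrite !inE -!orbA => /or4P[]/eqP->.
have sC a b : sqdist p a b = sqdist p b a by rewrite /sqdist !dotvE; ring.
have [Exy Exz Exw] : [/\ sqdist p x y = q x y, sqdist p x z = q x z
    & sqdist p x w = q x w].
  by rewrite !sqdistE px py pz pw !subr0.
have [Eyz Eyw Ezw] : [/\ sqdist p y z = q y z, sqdist p y w = q y w
    & sqdist p z w = q z w].
  rewrite /sqdist py pz pw !dotvE (dotvC v u) (dotvC t u) (dotvC t v).
  by rewrite uu vv tt uv ut vt /gram; split; field.
by move=> a b; rewrite !inE -!orbA => /or4P[]/eqP-> /or4P[]/eqP->;
  rewrite ?eqxx// => _; rewrite // sC qC.
Qed.

(** The length between two vertices, with value 0 when they do not span an edge
    of the complex (in particular when they are equal). *)
Definition edge_length (R : realType) (V : finType) (K : {set {set V}})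
    (l : edge_lengths R K) (u v : V) : R :=
  if (insub [set u; v]%SET : option (edge K)) is Some e then l e else 0.

Definition sqlen (R : realType) (V : finType) (K : {set {set V}})
    (l : edge_lengths R K) (u v : V) : R := edge_length l u v ^+ 2.

Lemma edge_lengthE (R : realType) (V : finType) (K : {set {set V}})
    (l : edge_lengths R K) (e : edge K) (u v : V) :
  \val e = [set u; v]%SET -> edge_length l u v = l e.
Proof. by rewrite /edge_length => <-; rewrite valK. Qed.

Lemma sqlenC (R : realType) (V : finType) (K : {set {set V}})
    (l : edge_lengths R K) (u v : V) : sqlen l u v = sqlen l v u.
Proof. by rewrite /sqlen /edge_length finset.setUC. Qed.

Lemma exists_edge (V : finType) (K : {set {set V}}) (t : {set V}) (u v : V) :
  simplicial_complex K -> t \in K -> u \in t -> v \in t -> u != v ->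
  exists e : edge K, \val e = [set u; v]%SET.
Proof.
move=> [_ Ksub] tK ut vt uv.
have eP : ([set u; v]%SET \in K) && (#|[set u; v]%SET| == 2%N).
  rewrite cards2 uv eqxx andbT; apply: (Ksub t) => //.
    by apply/fintype.subsetP => k; rewrite !inE => /orP[]/eqP->.
  by apply/set0Pn; exists u; rewrite !inE eqxx.
by exists (Sub [set u; v]%SET eP); rewrite SubK.
Qed.

Lemma sqdist_realizes (R : realType) (V : finType) (K : {set {set V}})
    (l : edge_lengths R K) (t : {set V}) (p : V -> 'rV[R]_3) (u v : V) :
  simplicial_complex K -> t \in K -> realizes l t p ->
  u \in t -> v \in t -> u != v -> sqdist p u v = sqlen l u v.
Proof.
move=> KS tK [_ pl] ut vt uv; have [e eE] := exists_edge KS tK ut vt uv.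
rewrite /sqlen (edge_lengthE l eE) -(pl e u v eE) ?sqr_enorm//.
by rewrite eE; apply/fintype.subsetP => k; rewrite !inE => /orP[]/eqP->.
Qed.

Lemma uniq_card4 (V : finType) (x y z w : V) :
  #|[set x; y; z; w]%SET| = 4%N -> uniq [:: x; y; z; w].
Proof.
move=> c4; apply/card_uniqP; rewrite /= -[RHS]c4; apply: eq_card => k.
by rewrite !inE !orbA.
Qed.

Lemma dihq_ext (R : realType) (V : eqType) (q q' : V -> V -> R) (x y z w : V) :
  uniq [:: x; y; z; w] ->
  (forall u v, u \in [:: x; y; z; w] -> v \in [:: x; y; z; w] -> u != v ->
     q u v = q' u v) ->
  dihq q x y z w = dihq q' x y z w.
Proof.
rewrite /= !inE !negb_or => /and4P[/and3P[xy xz xw] /andP[yz yw] zw _] qq'.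
by rewrite /dihq /cosnum /area /gram !qq'// !inE eqxx ?orbT.
Qed.

(** Two namings of the vertices of a tetrahedron for which the first two vertices
    span the same edge differ by exchanging the first two vertices, or the last
    two, or both. *)
Lemma dihq_naming (R : realType) (V : finType) (q : V -> V -> R)
    (x y z w x' y' z' w' : V) :
  (forall u v, q u v = q v u) ->
  uniq [:: x; y; z; w] -> uniq [:: x'; y'; z'; w'] ->
  [set x'; y']%SET = [set x; y]%SET ->
  [set x'; y'; z'; w']%SET = [set x; y; z; w]%SET ->
  dihq q x' y' z' w' = dihq q x y z w.
Proof.
move=> qC U U' /setP E2 /setP E4.
have := E2 x'; have := E2 y'; have := E4 z'; have := E4 w'; move: U U'.
rewrite /= !inE !eqxx !orbT /= !negb_or.
move=> /and4P[/and3P[xy xz xw] /andP[yz yw] zw _].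
move=> /and4P[/and3P[xy' xz' xw'] /andP[yz' yw'] zw' _].
move=> /esym W /esym Z /esym/orP[]/eqP Y /esym/orP[]/eqP X; subst x' y';
  rewrite ?eqxx// in xy'; move: W Z;
  rewrite !(eq_sym z') !(eq_sym w') (negPf xz') (negPf xw') (negPf yz')
    (negPf yw') /= => /orP[]/eqP W /orP[]/eqP Z; subst z' w';
  rewrite ?eqxx// in zw' *; rewrite ?[dihq q y x _ _]dihq_swap_ends//;
  by rewrite dihq_swap_apices.
Qed.

(** The dihedral angle does not depend on the placement and the naming of the
    vertices, and is given by the formula in the squared lengths. *)
Lemma dihedral_angleE (R : realType) (V : finType) (K : {set {set V}})
    (l : edge_lengths R K) (t : {set V}) (a : edge K) (x y z w : V) :
  simplicial_complex K -> t \in tetrahedra K -> euclidean_tetrahedron l t ->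
  \val a = [set x; y]%SET -> t = [set x; y; z; w]%SET ->
  dihedral_angle l t a = dihq (sqlen l) x y z w.
Proof.
move=> KS; rewrite inE => /andP[tK /eqP t4] [p0 p0P] aE tE.
have U : uniq [:: x; y; z; w] by apply: uniq_card4; rewrite -tE.
have main p x' y' z' w' : realizes l t p -> \val a = [set x'; y']%SET ->
    t = [set x'; y'; z'; w']%SET ->
    dihedral (p x') (p y') (p z') (p w') = dihq (sqlen l) x y z w.
  move=> pP aE' tE'.
  have U' : uniq [:: x'; y'; z'; w'] by apply: uniq_card4; rewrite -tE'.
  have pI := pP.1; rewrite tE' in pI.
  have [xy0 _ _] := affinely_independent_gt0 U' pI.
  have e2 : [set x'; y']%SET = [set x; y]%SET by rewrite -aE -aE'.
  have e4 : [set x'; y'; z'; w']%SET = [set x; y; z; w]%SET by rewrite -tE -tE'.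
  rewrite dihedral_dihq// -(dihq_naming (sqlenC l) U U' e2 e4).
  apply: dihq_ext => // u v uU vU uv.
  have tP k : k \in [:: x'; y'; z'; w'] -> k \in t by rewrite tE' !inE !orbA.
  exact: (sqdist_realizes KS tK pP (tP _ uU) (tP _ vU) uv).
apply: xget_unique.
  by exists p0, x, y, z, w; split=> //; rewrite (main p0).
by move=> _ [p [x' [y' [z' [w' [pP aE' tE' ->]]]]]]; exact: main.
Qed.

(** * Varying one edge length *)

Lemma gram_ext (R : realType) (V : eqType) (q q' : V -> V -> R) (x y z w : V) :
  uniq [:: x; y; z; w] ->
  (forall u v, u \in [:: x; y; z; w] -> v \in [:: x; y; z; w] -> u != v ->
     q u v = q' u v) ->
  [/\ q x y = q' x y, area q x y z = area q' x y z
    & gramdet q x y z w = gramdet q' x y z w].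
Proof.
rewrite /= !inE !negb_or => /and4P[/and3P[xy xz xw] /andP[yz yw] zw _] qq'.
by rewrite /gramdet /area /gram !qq'// !inE eqxx ?orbT.
Qed.

Lemma euclidean_gt0 (R : realType) (V : finType) (K : {set {set V}})
    (l : edge_lengths R K) (t : {set V}) (x y z w : V) :
  simplicial_complex K -> t \in K -> euclidean_tetrahedron l t ->
  uniq [:: x; y; z; w] -> t = [set x; y; z; w]%SET ->
  [/\ 0 < sqlen l x y, 0 < area (sqlen l) x y z
    & 0 < gramdet (sqlen l) x y z w].
Proof.
move=> KS tK [p pP] U tE.
have tP k : k \in [:: x; y; z; w] -> k \in t by rewrite tE !inE !orbA.
have [|<- <- <-] := @gram_ext R V (sqdist p) (sqlen l) _ _ _ _ U.
  by move=> u v /tP ut /tP vt uv; exact: sqdist_realizes KS tK pP ut vt uv.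
by apply: affinely_independent_gt0 => //; rewrite -tE; exact: pP.1.
Qed.

Lemma euclidean_of_gt0 (R : realType) (V : finType) (K : {set {set V}})
    (l : edge_lengths R K) (t : {set V}) (x y z w : V) :
  uniq [:: x; y; z; w] -> t = [set x; y; z; w]%SET ->
  (forall e : edge K, \val e \subset t -> 0 <= l e) ->
  0 < sqlen l x y -> 0 < area (sqlen l) x y z ->
  0 < gramdet (sqlen l) x y z w -> euclidean_tetrahedron l t.
Proof.
move=> U tE l0 q0 a0 d0.
have [p pI pq] := exists_placement U (sqlenC l) q0 a0 d0.
rewrite -tE in pI pq; exists p; split=> // e u v eE et.
have uv : u != v.
  by have /andP[_] := valP e; rewrite eE cards2; case: (u != v).
have := et; rewrite {1}eE => /fintype.subsetP euv.
have ut : u \in t by apply: euv; rewrite !inE eqxx.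
have vt : v \in t by apply: euv; rewrite !inE eqxx orbT.
have := pq u v ut vt uv; rewrite /sqlen (edge_lengthE l eE) /enorm /sqdist => ->.
by rewrite sqrtr_sqr ger0_norm// l0.
Qed.

(** Edges of a nondegenerate tetrahedron have positive length: otherwise the
    weights 1 and -1 at the two endpoints would be an affine dependence. *)
Lemma euclidean_edge_gt0 (R : realType) (V : finType) (K : {set {set V}})
    (l : edge_lengths R K) (t : {set V}) (e : edge K) :
  simplicial_complex K -> t \in tetrahedra K -> euclidean_tetrahedron l t ->
  \val e \subset t -> 0 < l e.
Proof.
move=> KS; rewrite inE => /andP[tK /eqP t4] [p pP] et.
have /andP[_ /cards2P[u [v [uv eE]]]] := valP e.
rewrite -(pP.2 e u v eE et) sqrtr_gt0.
have := et; rewrite eE => /fintype.subsetP euv.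
apply: dotv_gt0; rewrite subr_eq0; apply/eqP => puv.
have ut : u \in t by apply: euv; rewrite !inE eqxx.
have vt : v \in t by apply: euv; rewrite !inE eqxx orbT.
pose c k : R := (k == u)%:R - (k == v)%:R.
have cu : c u = 1 by rewrite /c eqxx (negPf uv) subr0.
have /eqP : c u = 0.
  have sumP (U : zmodType) (F : V -> U) k : k \in t ->
      \sum_(x in t) F x *+ (x == k) = F k.
    move=> kt; rewrite (bigD1 k)//= eqxx big1 ?addr0// => j /andP[_ /negPf->].
    by rewrite mulr0n.
  apply: (pP.1 c) => //; first by rewrite sumrB !sumP// subrr.
  transitivity (\sum_(x in t) (p x *+ (x == u) - p x *+ (x == v))).
    by apply: eq_bigr => x _; rewrite scalerBl !scaler_nat.
  by rewrite sumrB !sumP// puv subrr.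
by rewrite cu oner_eq0.
Qed.

(** The lengths [l] with the length of the edge [b] replaced by [s], so that
    [along F l b s] is [F (vary l b s)]. *)
Definition vary (R : realType) (V : finType) (K : {set {set V}})
    (l : edge_lengths R K) (b : edge K) (s : R) : edge_lengths R K :=
  [eta l with b |-> s].

Lemma vary_id (R : realType) (V : finType) (K : {set {set V}})
    (l : edge_lengths R K) (b : edge K) : vary l b (l b) = l.
Proof. by apply/funext => e; rewrite /vary /=; case: eqP => // ->. Qed.

Lemma edge_length_vary (R : realType) (V : finType) (K : {set {set V}})
    (l : edge_lengths R K) (b : edge K) (s : R) (u v : V) :
  edge_length (vary l b s) u v =
  if [set u; v]%SET == \val b then s else edge_length l u v.
Proof.
have [uvb|uvb] := eqVneq [set u; v]%SET (\val b).
  by rewrite (edge_lengthE _ (esym uvb)) /vary /= eqxx.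
rewrite /edge_length; case: insubP => [e _ eE|//].
rewrite /vary /=; case: eqP => // eb; by rewrite -eE eb eqxx in uvb.
Qed.

(** The derivative at [l b] of the squared lengths, with respect to the length
    of [b]. *)
Definition dsqlen (R : realType) (V : finType) (K : {set {set V}})
    (l : edge_lengths R K) (b : edge K) (u v : V) : R :=
  if [set u; v]%SET == \val b then 2 * l b else 0.

Lemma is_derive_sqlen_vary (R : realType) (V : finType) (K : {set {set V}})
    (l : edge_lengths R K) (b : edge K) (u v : V) :
  is_derive (l b) 1 (fun s => sqlen (vary l b s) u v) (dsqlen l b u v).
Proof.
rewrite /sqlen /dsqlen.
have [uvb|uvb] := eqVneq [set u; v]%SET (\val b).
  have H : is_derive (l b) 1 (fun s : R => s * s) (l b * 1 + l b * 1).
    exact: (is_deriveM (is_derive_id (l b) 1) (is_derive_id (l b) 1)).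
  have {}H : is_derive (l b) 1 (fun s : R => s * s) (2 * l b).
    by apply: (is_derive_eq H); ring.
  apply: near_eq_is_derive H; near=> s.
  by rewrite edge_length_vary uvb eqxx expr2.
have H := is_derive_cst (edge_length l u v ^+ 2) (l b) 1.
apply: near_eq_is_derive H; near=> s.
by rewrite edge_length_vary (negPf uvb).
Unshelve. all: by end_near.
Qed.

Lemma is_derive_near_gt0 (R : realType) (f : R -> R) (s df : R) :
  is_derive s 1 f df -> 0 < f s -> \forall r \near s, 0 < f r.
Proof.
move=> [fD _] f0; have /differentiable_continuous fc : differentiable f s.
  exact/derivable1_diffP.
exact: (cvgr_gt (f s) fc).
Qed.

(** The vertices of a tetrahedron can be named starting from a given edge. *)
Lemma name_tetrahedron (V : finType) (a t : {set V}) :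
  #|a| = 2%N -> #|t| = 4%N -> a \subset t ->
  exists x y z w, a = [set x; y]%SET /\ t = [set x; y; z; w]%SET.
Proof.
move=> a2 t4 at_; have : #|t :\: a|%SET = 2%N.
  by have := cardsID a t; rewrite (finset.setIidPr at_) a2 t4 => -[].
move/eqP/cards2P => [z [w [_ zwE]]]; move/eqP/cards2P: (a2) => [x [y [_ aE]]].
exists x, y, z, w; split=> //.
rewrite -(finset.setID t a) (finset.setIidPr at_) zwE {1}aE.
by apply/setP => k; rewrite !inE !orbA.
Qed.

(** Nondegeneracy of a tetrahedron is preserved by small changes of the length of
    one of its edges. *)
Lemma near_euclidean_vary (R : realType) (V : finType) (K : {set {set V}})
    (l : edge_lengths R K) (t : {set V}) (b : edge K) :
  simplicial_complex K -> t \in tetrahedra K -> euclidean_tetrahedron l t ->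
  \val b \subset t ->
  \forall s \near l b, euclidean_tetrahedron (vary l b s) t.
Proof.
move=> KS tT lt bt; have := tT; rewrite inE => /andP[tK /eqP t4].
have lb0 := euclidean_edge_gt0 KS tT lt bt.
have /andP[_ /eqP b2] := valP b.
have [x [y [z [w [_ tE]]]]] := name_tetrahedron b2 t4 bt.
have U : uniq [:: x; y; z; w] by apply: uniq_card4; rewrite -tE.
have [q0 a0 d0] := euclidean_gt0 KS tK lt U tE.
have qD := is_derive_sqlen_vary l b.
have q1 : \forall s \near l b, 0 < sqlen (vary l b s) x y.
  by apply: (is_derive_near_gt0 (qD x y)); rewrite vary_id.
have a1 : \forall s \near l b, 0 < area (sqlen (vary l b s)) x y z.
  by apply: (is_derive_near_gt0 (is_derive_area x y z qD)); rewrite vary_id.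
(* By [area_mul], q xy times the determinant is M M' - N^2,
   a function that is differentiable and positive at the given length. *)
have d1 : \forall s \near l b, 0 < gramdet (sqlen (vary l b s)) x y z w.
  have nD := is_derive_cosnum x y z w qD.
  have D : is_derive (l b) 1 (fun s => area (sqlen (vary l b s)) x y z
     * area (sqlen (vary l b s)) x y w - cosnum (sqlen (vary l b s)) x y z w
     * cosnum (sqlen (vary l b s)) x y z w) _ := is_deriveB (is_deriveM
    (is_derive_area x y z qD) (is_derive_area x y w qD)) (is_deriveM nD nD).
  have D0 : \forall s \near l b, 0 < area (sqlen (vary l b s)) x y z
     * area (sqlen (vary l b s)) x y w - cosnum (sqlen (vary l b s)) x y z w
     * cosnum (sqlen (vary l b s)) x y z w.
    by apply: (is_derive_near_gt0 D); rewrite vary_id -expr2 area_mul mulr_gt0.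
  near=> s.
  have qs : 0 < sqlen (vary l b s) x y by near: s.
  rewrite -(pmulr_rgt0 _ qs) -area_mul expr2.
  by near: s.
near=> s.
apply: (euclidean_of_gt0 U tE); [|by near: s..].
move=> e et; rewrite /vary /=; case: eqP => _; last first.
  exact: ltW (euclidean_edge_gt0 KS tT lt et).
by apply: ltW; near: s; exact: lt_nbhsr.
Unshelve. all: by end_near.
Qed.

Lemma is_derive_dihedral_angle (R : realType) (V : finType) (K : {set {set V}})
    (l : edge_lengths R K) (t : {set V}) (a b : edge K) (x y z w : V) :
  simplicial_complex K -> t \in tetrahedra K -> euclidean_tetrahedron l t ->
  \val b \subset t -> \val a = [set x; y]%SET -> t = [set x; y; z; w]%SET ->
  is_derive (l b) 1 (along (fun l' => dihedral_angle l' t a) l b)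
    (ddihq (sqlen l) (dsqlen l b) x y z w).
Proof.
move=> KS tT lt bt aE tE; have := tT; rewrite inE => /andP[tK /eqP t4].
have U : uniq [:: x; y; z; w] by apply: uniq_card4; rewrite -tE.
have [q0 a0 d0] := euclidean_gt0 KS tK lt U tE.
have U' : uniq [:: x; y; w; z].
  by move: U; rewrite /= !inE !negb_or (eq_sym w z) => /and4P[/and3P[-> -> ->]
    /andP[-> ->] -> _].
have [|_ a0' _] := euclidean_gt0 KS tK lt U'.
  by rewrite tE -!finset.setUA [([set z] :|: _)%SET]finset.setUC.
have H := @is_derive_dihq _ _ _ _ _ x y z w (is_derive_sqlen_vary l b).
rewrite vary_id in H; have {}H := H q0 a0 a0' d0.
apply: near_eq_is_derive H; near=> s.
rewrite /along -(dihedral_angleE KS tT _ aE tE)//.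
by near: s; exact: near_euclidean_vary.
Unshelve. all: by end_near.
Qed.

(** Two distinct edges of a tetrahedron are opposite or share a vertex. *)
Lemma edge_pair (V : finType) (a b t : {set V}) :
  #|a| = 2%N -> #|b| = 2%N -> #|t| = 4%N -> a \subset t -> b \subset t ->
  a != b ->
  exists x y z w, [/\ a = [set x; y]%SET, t = [set x; y; z; w]%SET &
    b = [set z; w]%SET \/ b = [set x; z]%SET].
Proof.
move=> a2 b2 t4 at_ bt ab.
have [x [y [z [w [aE tE]]]]] := name_tetrahedron a2 t4 at_.
move/eqP/cards2P: b2 => [u [v [uv bE]]]; subst a b.
have ut : u \in t by apply: (fintype.subsetP bt); rewrite !inE eqxx.
have vt : v \in t by apply: (fintype.subsetP bt); rewrite !inE eqxx orbT.
have sw1 : [set x; y]%SET = [set y; x]%SET by rewrite finset.setUC.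
have sw2 : t = [set x; y; w; z]%SET.
  by rewrite tE; apply/setP => k; rewrite !inE -!orbA; do !bool_congr.
have sw3 : t = [set y; x; z; w]%SET.
  by rewrite tE; apply/setP => k; rewrite !inE -!orbA; do !bool_congr.
have sw4 : t = [set y; x; w; z]%SET.
  by rewrite tE; apply/setP => k; rewrite !inE -!orbA; do !bool_congr.
have C := @finset.setUC V.
move: ut vt uv ab; rewrite {1 2}tE !inE -!orbA.
  move=> /or4P[]/eqP-> /or4P[]/eqP->; rewrite ?eqxx// => _;
    rewrite ?[([set y] :|: [set x])%SET]C ?eqxx// => _.
  all: first
    [ by exists x, y, z, w; split=> //; right
    | by exists x, y, z, w; split=> //; right; rewrite C
    | by exists x, y, w, z; split=> //; right
    | by exists x, y, w, z; split=> //; right; rewrite C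
    | by exists y, x, z, w; split=> //; right
    | by exists y, x, z, w; split=> //; right; rewrite C
    | by exists y, x, w, z; split=> //; right
    | by exists y, x, w, z; split=> //; right; rewrite C
    | by exists x, y, z, w; split=> //; left
    | by exists x, y, z, w; split=> //; left; rewrite C ].
Qed.

(** * Symmetry of the derivatives *)

Lemma dsqlen_eq0 (R : realType) (V : finType) (K : {set {set V}})
    (l : edge_lengths R K) (b : edge K) (u v : V) :
  (u \notin \val b) || (v \notin \val b) -> dsqlen l b u v = 0.
Proof.
rewrite /dsqlen; case: eqP => // <-; by rewrite !inE !eqxx orbT.
Qed.

(** The symmetry of the derivatives of the dihedral angles of one tetrahedron. *)
Lemma tetrahedron_schlafli (R : realType) (V : finType) (K : {set {set V}})
    (l : edge_lengths R K) (t : {set V}) (a b : edge K) :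
  simplicial_complex K -> t \in tetrahedra K -> euclidean_tetrahedron l t ->
  \val a \subset t -> \val b \subset t ->
  exists D : R,
    is_derive (l b) 1 (along (fun l' => dihedral_angle l' t a) l b) D /\
    is_derive (l a) 1 (along (fun l' => dihedral_angle l' t b) l a) D.
Proof.
move=> KS tT lt aT bT; have := tT; rewrite inE => /andP[tK /eqP t4].
have /andP[_ /eqP a2] := valP a; have /andP[_ /eqP b2] := valP b.
have [<-|ab] := eqVneq a b.
  have [x [y [z [w [aE tE]]]]] := name_tetrahedron a2 t4 aT.
  by exists (ddihq (sqlen l) (dsqlen l a) x y z w); split;
    exact: is_derive_dihedral_angle.
have [x [y [z [w [aE tE bE]]]]] := edge_pair a2 b2 t4 aT bT ab.
have U : uniq [:: x; y; z; w] by apply: uniq_card4; rewrite -tE.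
have [q0 a0 d0] := euclidean_gt0 KS tK lt U tE.
have la0 := euclidean_edge_gt0 KS tT lt aT.
have lb0 := euclidean_edge_gt0 KS tT lt bT.
have lenE (e : edge K) u v : \val e = [set u; v]%SET ->
    sqlen l u v = l e ^+ 2 /\ dsqlen l e u v = 2 * l e.
  by move=> eE; rewrite /sqlen (edge_lengthE l eE) /dsqlen eE eqxx.
have [qa da] := lenE a x y aE.
have C : forall u v, sqlen l u v = sqlen l v u := sqlenC l.
have U1 := U; rewrite /= !inE !negb_or in U1.
case/and4P: U1 => /and3P[xy xz xw] /andP[yz yw] zw _.
have D1 := is_derive_dihedral_angle KS tT lt bT aE tE.
exists (ddihq (sqlen l) (dsqlen l b) x y z w); split=> //.
case: bE => bE; have [qb db] := lenE b _ _ bE.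
- have tE' : t = [set z; w; x; y]%SET.
    by rewrite tE -finset.setUA finset.setUC finset.setUA.
  have D2 := is_derive_dihedral_angle KS tT lt aT bE tE'.
  apply: (is_derive_eq D2).
  have [bx by_] : x \notin \val b /\ y \notin \val b.
    by rewrite bE !inE !negb_or xz xw yz yw.
  have [az aw] : z \notin \val a /\ w \notin \val a.
    by rewrite aE !inE !negb_or !(eq_sym z) !(eq_sym w) xz xw yz yw.
  have -> : ddihq (sqlen l) (dsqlen l b) x y z w
      = l b * l a / Num.sqrt (gramdet (sqlen l) x y z w).
    by apply: ddihq_opposite => //; rewrite dsqlen_eq0 ?bx ?by_ ?orbT.
  have -> : ddihq (sqlen l) (dsqlen l a) z w x y
      = l a * l b / Num.sqrt (gramdet (sqlen l) z w x y).
    by apply: ddihq_opposite => //; rewrite dsqlen_eq0 ?az ?aw ?orbT.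
  by rewrite gramdet_opposite// [l b * _]mulrC.
- have tE' : t = [set x; z; y; w]%SET.
    by rewrite tE [([set x; y] :|: _)%SET]finset.setUAC.
  have D2 := is_derive_dihedral_angle KS tT lt aT bE tE'.
  apply: (is_derive_eq D2).
  have [by_ bw] : y \notin \val b /\ w \notin \val b.
    by rewrite bE !inE !negb_or !(eq_sym w) (eq_sym y x) xy yz xw zw.
  have [az aw] : z \notin \val a /\ w \notin \val a.
    by rewrite aE !inE !negb_or !(eq_sym z) !(eq_sym w) xz xw yz yw.
  rewrite (@ddihq_adjacent _ _ _ (dsqlen l b) x y z w (l b) (l a))//;
    try by rewrite dsqlen_eq0 ?by_ ?bw ?orbT.
  have a0' : 0 < area (sqlen l) x z y by rewrite area_adjacent.
  rewrite (@ddihq_adjacent _ _ _ (dsqlen l a) x z y w (l a) (l b))//;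
    try by rewrite dsqlen_eq0 ?az ?aw ?orbT.
  by rewrite gramdet_adjacent// area_adjacent// adjacent_factor_sym// [l b * _]mulrC.
Qed.

Lemma dihedral_angle_vary_out (R : realType) (V : finType) (K : {set {set V}})
    (l : edge_lengths R K) (t : {set V}) (a b : edge K) (s : R) :
  ~~ (\val b \subset t) ->
  dihedral_angle (vary l b s) t a = dihedral_angle l t a.
Proof.
move=> bt; rewrite /dihedral_angle; congr (get _).
have E p : realizes (vary l b s) t p <-> realizes l t p.
  have E (e : edge K) : \val e \subset t -> vary l b s e = l e.
    by move=> et; rewrite /vary /=; case: eqP => // eb; rewrite -eb et in bt.
  by split=> -[pI pl]; split=> // e x y eE et; rewrite (pl e x y eE et) E.
apply/seteqP; split=> theta [p [x [y [z [w [pP aE tE thE]]]]]];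
  by exists p, x, y, z, w; split=> //; apply/E.
Qed.

Lemma is_derive_bigsum (R : realType) (I : Type) (r : seq I) (P : pred I)
    (f : I -> R -> R) (df : I -> R) (s : R) :
  (forall i, P i -> is_derive s 1 (f i) (df i)) ->
  is_derive s 1 (fun u => \sum_(i <- r | P i) f i u) (\sum_(i <- r | P i) df i).
Proof.
move=> fD; elim: r => [|i r IH].
  under eq_fun do rewrite big_nil.
  by rewrite big_nil; exact: is_derive_cst.
under eq_fun do rewrite big_cons.
rewrite big_cons; case: ifP => // Pi; exact: is_deriveD (fD i Pi) IH.
Qed.

Lemma angle_sum_symmetric (R : realType) (V : finType) (K : {set {set V}})
    (l : edge_lengths R K) (a b : edge K) :
  simplicial_complex K ->
  (forall t, t \in tetrahedra K -> euclidean_tetrahedron l t) ->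
  exists D : R,
    is_derive (l b) 1 (along (fun l' => angle_sum l' a) l b) D /\
    is_derive (l a) 1 (along (fun l' => angle_sum l' b) l a) D.
Proof.
move=> KS lT.
pose D (a b : edge K) t := derive1 (along (fun l' => dihedral_angle l' t a) l b) (l b).
have DP (c e : edge K) t : t \in tetrahedra K -> \val c \subset t ->
    \val e \subset t ->
    is_derive (l e) 1 (along (fun l' => dihedral_angle l' t c) l e) (D c e t)
    /\ D c e t = D e c t.
  move=> tT ct et; have [d [d1 d2]] := tetrahedron_schlafli KS tT (lT t tT) ct et.
  by rewrite /D !derive1E (@derive_val _ _ _ _ _ _ _ d1) (@derive_val _ _ _ _ _ _ _ d2).
have sumD (c e : edge K) :
    is_derive (l e) 1 (along (fun l' => angle_sum l' c) l e)
      (\sum_(t | [&& t \in tetrahedra K, \val c \subset t & \val e \subset t])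
         D c e t).
  rewrite /along /angle_sum.
  have -> : \sum_(t | [&& t \in tetrahedra K, \val c \subset t & \val e \subset t])
         D c e t = \sum_(t in tetrahedra K | \val c \subset t)
           if \val e \subset t then D c e t else 0.
    by rewrite -big_mkcondr; apply: eq_bigl => t; rewrite andbA.
  apply: is_derive_bigsum => t /andP[tT ct]; case: ifP => et.
    by have [] := DP c e t tT ct et.
  have H := is_derive_cst (dihedral_angle l t c) (l e) 1.
  apply: near_eq_is_derive H; near=> s.
  by rewrite -[RHS]/(dihedral_angle (vary l e s) t c) dihedral_angle_vary_out ?et.
exists (\sum_(t | [&& t \in tetrahedra K, \val a \subset t & \val b \subset t])
         D a b t); split; first exact: sumD.
apply: (is_derive_eq (sumD b a)).
rewrite [RHS](eq_bigl (fun t => [&& t \in tetrahedra K, \val b \subset t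
  & \val a \subset t])).
  by apply: eq_bigr => t /and3P[tT bt at_]; have [] := DP b a t tT bt at_.
by move=> t; rewrite [X in _ && X]andbC.
Unshelve. all: by end_near.
Qed.

(** Two functions that are continuous at a point and congruent modulo 2 pi nearby
    differ by a constant nearby. *)
Lemma near_constant_mod_2pi (R : realType) (f g : R -> R) (s : R) :
  {for s, continuous f} -> {for s, continuous g} ->
  (\forall r \near s, eq_mod_2pi (f r) (g r)) ->
  \forall r \near s, f r = g r + (f s - g s).
Proof.
move=> fc gc fg; have [k0 k0E] := nbhs_singleton fg.
have pi2 : 0 < 2 * pi :> R by rewrite mulr_gt0// pi_gt0.
have hc : (fun r => f r - g r) @ s --> f s - g s by exact: cvgB.
move/cvgrPdist_lt: hc => /(_ _ pi2) hnear.
near=> r.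
have [k kE] : eq_mod_2pi (f r) (g r) by near: r.
have : `|f s - g s - (f r - g r)| < 2 * pi by near: r.
rewrite k0E kE [g s + _]addrC [g r + _]addrC !addrK -mulrBr normrM gtr0_norm//.
rewrite gtr_pMr// -intrB -intr_norm -[1]/(1%:~R) ltr_int => kk.
have /eqP : k0 - k = 0 by move: kk; case: (k0 - k) => [[|n]|n].
by rewrite subr_eq0 addrC => /eqP->.
Unshelve. all: by end_near.
Qed.

Lemma cvg_vary (R : realType) (V : finType) (K : {set {set V}})
    (l : edge_lengths R K) (b : edge K) :
  vary l b @ l b --> l.
Proof.
have -> : vary l b = @dfwith (edge K) (fun=> R) l b.
  apply/funext => s; apply/funext => e; rewrite /vary /=.
  by case: eqVneq => [->|eb]; rewrite ?dfwithin ?dfwithout// eq_sym.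
rewrite -[X in _ --> X](vary_id l b).
have -> : vary l b (l b) = @dfwith (edge K) (fun=> R) l b (l b).
  apply/funext => e; rewrite /vary /=.
  by case: eqVneq => [->|eb]; rewrite ?dfwithin ?dfwithout// eq_sym.
exact: (@dfwith_continuous (edge K) (fun=> R) l b (l b)).
Qed.

Lemma is_derive_defect (R : realType) (V : finType) (K : {set {set V}})
    (l : edge_lengths R K) (omega : edge K -> edge_lengths R K -> R)
    (a b : edge K) (D : R) :
  defect_angles_near l omega ->
  is_derive (l b) 1 (along (fun l' => angle_sum l' a) l b) D ->
  is_derive (l b) 1 (along (omega a) l b) (- D).
Proof.
move=> /(_ a)[oc omod] sD; have ND := is_deriveN sD.
have gc : {for l b, continuous (- along (fun l' => angle_sum l' a) l b)}.
  by case: ND => /derivable1_diffP/differentiable_continuous.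
have fc : {for l b, continuous (along (omega a) l b)}.
  have E : along (omega a) l b (l b) = omega a l.
    by rewrite -[LHS]/(omega a (vary l b (l b))) vary_id.
  suff : along (omega a) l b @ l b --> along (omega a) l b (l b) by [].
  rewrite E.
  have oc' : omega a @ l --> omega a l := oc.
  exact: (cvg_comp (vary l b) (omega a) (@cvg_vary R V K l b) oc').
have /(near_constant_mod_2pi fc gc) fg : \forall s \near l b,
    eq_mod_2pi (along (omega a) l b s) ((- along (fun l' => angle_sum l' a) l b) s).
  exact: (@cvg_vary R V K l b _ omod).
set c := _ - _ in fg.
have H := is_deriveD ND (is_derive_cst c (l b) 1).
rewrite addr0 in H; apply: near_eq_is_derive H.
by near=> s; apply/esym; near: s.
Unshelve. all: by end_near.
Qed.

Theorem theorem2 (R : realType) (V : finType) (K : {set {set V}})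
    (l : edge_lengths R K) (omega : edge K -> edge_lengths R K -> R) :
  simplicial_complex K ->
  made_of_tetrahedra K ->
  two_tetrahedra_at_each_face K ->
  (forall t : {set V}, t \in tetrahedra K -> euclidean_tetrahedron l t) ->
  defect_angles_near l omega ->
  forall a b : edge K,
    [/\ derivable (along (omega a) l b) (l b) 1,
        derivable (along (omega b) l a) (l a) 1
      & derive1 (along (omega a) l b) (l b) =
        derive1 (along (omega b) l a) (l a)].
Proof.
move=> KS _ _ lT omegaP a b.
have [D [abD baD]] := angle_sum_symmetric a b KS lT.
have oab := is_derive_defect omegaP abD; have oba := is_derive_defect omegaP baD.
split; first exact: ex_derive.
  exact: ex_derive.
by rewrite !derive1E !derive_val.
Qed.
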